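(* Let $\mathcal{R}$ be the set of all integers of the form $2^k+2$ with $k \geq 1$ or of the form $2^s+2^t-4$ with $s \geq t \geq 2$ ($k,s,t$ integers). Let $n$ be an even integer. Then $n$ can be written as $$n = \sum_{j=1}^{l} (2^{i_j}-2) + r,$$ where $r \in \mathcal{R}$, $l \geq 0$ (the sum being empty if $l=0$), $i_1 > i_2 > \cdots > i_l \geq 2$ are integers, and $l$ is the smallest number with this property. Moreover, for this $l$, $$\mathrm{sa}(Q_n) \leq \frac{n}{2} + l + 2.$$
   Context: For an integer $n \geq 1$, $Q_n$ denotes the $n$-dimensional hypercube: the graph whose vertices are all binary vectors of length $n$, two vertices being adjacent if and only if they differ in exactly one coordinate. A star is a complete bipartite graph $K_{1,m}$ with $m\ge 1$. A galaxy (star forest) is a union of vertex-disjoint stars. The star arboricity $\mathrm{sa}(G)$ of a finite simple graph $G$ is the minimum number of galaxies (subgraphs of $G$) whose edge sets partition the edge set of $G$.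
   Formalization: The even integer n is assumed to be at least 4: every r in R is at least 4 and every term 2^i−2 is positive, so no even n ≤ 2 (e.g. n = 2) can be written in the claimed form. *)

(* Defs.v *)
From mathcomp Require Import all_boot.

Set Implicit Arguments.
Unset Strict Implicit.
Unset Printing Implicit Defensive.

Record sgraph := SGraph {
  vertex :> finType;
  adj : rel vertex;
  adj_sym : symmetric adj;
  adj_irrefl : irreflexive adj }.

Definition edges (G : sgraph) : {set {set G}} :=
  [set e | [exists x, exists y, adj x y && (e == [set x; y])]].

(* Stars and galaxies have no isolated vertices, so they are identified with
   their edge sets; the vertex set of an edge set S is cover S. *)

(* S is the edge set of a K_{1,m}, m >= 1, with centre c and leaves L. *)
Definition star (T : finType) (S : {set {set T}}) : bool :=
  [exists c : T, exists L : {set T},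
     [&& L != set0, c \notin L & S == [set [set c; x] | x in L]]].

Definition galaxy (T : finType) (F : {set {set T}}) : bool :=
  [exists P : {set {set {set T}}},
     [&& F == cover P,
         [forall S in P, star S]
       & [forall S1 in P, forall S2 in P,
            (S1 != S2) ==> [disjoint cover S1 & cover S2]]]].

Definition galaxy_partition (G : sgraph) (D : {set {set {set G}}}) : bool :=
  partition D (edges G) && [forall F in D, galaxy F].

Definition galaxy_partition_size (G : sgraph) : pred nat :=
  fun k => [exists D : {set {set {set G}}}, galaxy_partition D && (#|D| == k)].

Lemma galaxy_edge (G : sgraph) (e : {set G}) : e \in edges G -> galaxy [set e].
Proof.
rewrite inE => /existsP[x /existsP[y /andP[xy /eqP->]]].
apply/existsP; exists [set [set [set x; y]]]; apply/and3P; split.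
- by rewrite /cover big_set1.
- apply/forall_inP => S /set1P->.
  apply/existsP; exists x; apply/existsP; exists [set y]; apply/and3P; split.
  + by apply/set0Pn; exists y; rewrite inE.
  + by rewrite inE; apply: contraTneq xy => ->; rewrite adj_irrefl.
  + by rewrite imset_set1.
- apply/forall_inP => S1 /set1P->; apply/forall_inP => S2 /set1P->.
  by rewrite eqxx.
Qed.

Lemma galaxy_partition_exists (G : sgraph) :
  exists k, galaxy_partition_size G k.
Proof.
pose D : {set {set {set G}}} := [set [set e] | e in edges G].
exists #|D|; apply/existsP; exists D; rewrite eqxx andbT.
apply/andP; split; last first.
  by apply/forall_inP => F /imsetP[e eG ->]; apply: galaxy_edge.
apply/and3P; split.
- apply/eqP/setP => e; apply/bigcupP/idP.
    by case=> F /imsetP[f fG ->] /set1P->.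
  by move=> eG; exists [set e]; rewrite ?inE //; apply: imset_f.
- apply/trivIsetP => A B /imsetP[e _ ->] /imsetP[f _ ->] ef.
  by rewrite disjoints1 inE; apply: contraNneq ef => ->.
- apply/imsetP => -[e _ /setP/(_ e)].
  by rewrite !inE eqxx.
Qed.

Definition star_arboricity (G : sgraph) : nat :=
  ex_minn (galaxy_partition_exists G).

Definition cube_adj (n : nat) : rel (n.-tuple bool) :=
  fun u v => #|[set i : 'I_n | tnth u i != tnth v i]| == 1.

Lemma cube_adj_sym n : symmetric (@cube_adj n).
Proof.
move=> u v; rewrite /cube_adj; congr (_ == _); apply: eq_card => i.
by rewrite !inE eq_sym.
Qed.

Lemma cube_adj_irrefl n : irreflexive (@cube_adj n).
Proof.
move=> u; rewrite /cube_adj; apply/negbTE; rewrite neq_ltn.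
by rewrite ltnS leqn0 cards_eq0; apply/orP; left; apply/eqP/setP => i; rewrite !inE eqxx.
Qed.

Definition hypercube (n : nat) : sgraph :=
  SGraph (@cube_adj_sym n) (@cube_adj_irrefl n).

(* In the definitions below the bounds on the exponents keep every truncated
   subtraction exact. *)

Definition setR (r : nat) : Prop :=
  (exists2 k, 1 <= k & r = 2 ^ k + 2) \/
  (exists s t, [/\ 2 <= t, t <= s & r = 2 ^ s + 2 ^ t - 4]).

(* n = \sum_j (2 ^ i_j - 2) + r with r in setR and
   i_1 > i_2 > ... > i_l >= 2. *)
Definition representable (n l : nat) : Prop :=
  exists (i : l.-tuple nat) (r : nat),
    [/\ setR r, sorted gtn i, all (leq 2) i
      & n = \sum_(j < l) (2 ^ tnth i j - 2) + r].

(* Main.v *)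
Require Import Defs.
From mathcomp Require Import all_boot.
From mathcomp Require Import all_algebra zify.
From Stdlib Require Import Classical.

Set Implicit Arguments.
Unset Strict Implicit.
Unset Printing Implicit Defensive.

(** A galaxy is a set of arcs, each pointing from a leaf to the centre of its
    star, in which every vertex has at most one outgoing arc and no vertex has
    both an incoming and an outgoing one.

    Write n = 2p and view Q_n as the product of p copies of Q_2.  Each copy is
    a 4-cycle, oriented cyclically; this gives every vertex of Q_n exactly one
    outgoing and one incoming edge in each of the p directions.  Taking the
    parity of both coordinates in every copy maps Q_n onto Q_p, and the arcs of
    Q_n onto the arcs of the symmetric digraph of Q_p.  So it is enough to
    colour the arcs u -> v of that digraph with p + e colours such that the
    arcs leaving a vertex have distinct colours and none of these is the colour
    of an arc entering it: the pull-back splits Q_n into n/2 + e galaxies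
    (star_arboricity_half_cube).  The excess e is additive under cartesian
    products (half_cube_coloring_add), so two families suffice.

    For p = 2^m - 1 the excess is 1 (half_cube_coloring_hamming): colour u -> v
    by the Hamming syndrome of v, since the syndromes of the neighbours of u
    are exactly the values different from the syndrome of u.  For p = 2^m + 1
    the excess is 2 (half_cube_coloring_hamming_square): multiply the previous
    cube by Q_2 and use three more colours.

    The summands 2^i - 2 = 2 (2^(i-1) - 1) and 2^s + 2^t - 4 come from the
    first family, 2^k + 2 from the second, and the excesses add up to l + 2.
    A representation always exists because the greedy choice of the largest
    possible i leaves a remainder in which i can occur again only if that
    remainder is 2^i + 2, an element of R (representation_exists). *)

(** * Galaxies from arcs *)

(** An edge may lie in several of the colour classes here: it is assigned to
    one of them, and a subset of a galaxy is again a galaxy. *)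
Lemma star_arboricity_le_arcs (G : sgraph) (C : finType) (arc : C -> rel G) :
    (forall c x y z, arc c x y -> arc c x z -> y = z) ->
    (forall c x y z, arc c x y -> ~~ arc c y z) ->
    (forall x y, adj x y -> exists c, arc c x y || arc c y x) ->
  star_arboricity G <= #|C|.
Proof.
move=> arc_fun arc_head arc_cover.
pose ecol (e : {set G}) :=
  [pick c : C | [exists x, exists y, arc c x y && (e == [set x; y])]].
pose gal c := [set e in edges G | ecol e == Some c].
have ecolP e c : ecol e = Some c -> exists x y, arc c x y /\ e = [set x; y].
  rewrite /ecol; case: pickP => // c1 /= h [<-].
  have /existsP[x /existsP[y /andP[a /eqP->]]] := h.
  by exists x, y.
have ecol_edge e : e \in edges G -> exists c, ecol e = Some c.
  rewrite inE => /existsP[x /existsP[y /andP[/arc_cover[c ac] /eqP->]]].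
  rewrite /ecol; case: pickP => [c' _|/(_ c)]; first by exists c'.
  move=> /= /negbT /negP[]; case/orP: ac => ac.
    by apply/existsP; exists x; apply/existsP; exists y; rewrite ac eqxx.
  by apply/existsP; exists y; apply/existsP; exists x; rewrite ac setUC eqxx.
pose D := preim_partition ecol (edges G).
have partD : partition D (edges G) by apply: preim_partitionP.
have DE F : F \in D -> exists c, F = gal c.
  case/imsetP => e eG ->; have [c ec] := ecol_edge e eG.
  by exists c; apply/setP => f; rewrite !inE ec (eq_sym (Some c)).
have gal_galaxy c : galaxy (gal c).
  pose L y := [set x | arc c x y & [set x; y] \in gal c].
  pose S y := [set [set y; x] | x in L y].
  have coverS y z : z \in cover (S y) -> z = y \/ arc c z y.
    case/bigcupP => e /imsetP[x]; rewrite inE => /andP[a _] ->.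
    by rewrite !inE => /orP[] /eqP->; [left | right].
  have headS y z : z \in cover (S y) -> exists x, arc c x y.
    by case/bigcupP => e /imsetP[x]; rewrite inE => /andP[a _] _ _; exists x.
  apply/existsP; exists [set S y | y in [pred y | L y != set0]].
  apply/and3P; split.
  - rewrite /cover; apply/eqP/setP => e; apply/idP/bigcupP.
      move=> eF; have := eF; rewrite inE => /andP[_ /eqP /ecolP[x [y [a ee]]]].
      have xL : x \in L y by rewrite inE a -ee eF.
      exists (S y); first by apply: imset_f; rewrite inE; apply/set0Pn; exists x.
      by rewrite ee setUC; apply: imset_f.
    case=> T /imsetP[y _ {T}->] /imsetP[x]; rewrite in_set => /andP[_ xyF] ->.
    by rewrite setUC.
  - apply/forall_inP => T /imsetP[y]; rewrite inE => Ly {T}->.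
    apply/existsP; exists y; apply/existsP; exists (L y); rewrite Ly eqxx andbT /=.
    by rewrite inE; apply/negP => /andP[a]; have := arc_head c y y y a; rewrite a.
  - apply/forall_inP => T /imsetP[y _ {T}->]; apply/forall_inP => T /imsetP[z _ {T}->].
    apply/implyP; apply: contraNT => /pred0Pn[t /andP[/= ty tz]].
    have [[x1 a1] [x2 a2]] := (headS _ _ ty, headS _ _ tz).
    case: (coverS _ _ ty) => h1; case: (coverS _ _ tz) => h2.
    + by rewrite -h1 -h2.
    + by move: (arc_head _ _ _ z a1); rewrite -h1 h2.
    + by move: (arc_head _ _ _ y a2); rewrite -h2 h1.
    + by rewrite (arc_fun _ _ _ _ h1 h2).
rewrite /star_arboricity; case: ex_minnP => k _ kmin.
apply: leq_trans (kmin #|D| _) _.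
  apply/existsP; exists D; rewrite eqxx andbT; apply/andP; split=> //.
  by apply/forall_inP => F /DE[c ->].
apply: leq_trans (leq_imset_card gal C); apply: subset_leq_card.
by apply/subsetP => F /DE[c ->]; apply: imset_f.
Qed.

(** * Lifting arc colourings of a half-dimensional cube *)

Definition flip (I : finType) (u : {ffun I -> bool}) (i : I) : {ffun I -> bool} :=
  [ffun j => u j (+) (j == i)].

(** [col u i] colours the arc from [u] to [flip u i], and [Z u] contains the
    colours in which [u] may be a centre. *)
Definition arc_coloring (I C : finType)
    (Z : {ffun I -> bool} -> {set C}) (col : {ffun I -> bool} -> I -> C) : Prop :=
  [/\ forall u, injective (col u),
      forall u i, col u i \in Z (flip u i)
    & forall u i, col u i \notin Z u].

(** Dimensions are counted in the cube of twice the dimension, so that the excess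
    [e] is the amount by which the number of galaxies exceeds [n./2]. *)
Definition half_cube_coloring (n e : nat) : Prop :=
  exists (I C : finType) Z col,
    [/\ @arc_coloring I C Z col, n = #|I|.*2 & #|C| = #|I| + e].

Lemma cube_adjP n (v w : n.-tuple bool) :
  cube_adj v w -> exists k, forall j, tnth w j = tnth v j (+) (j == k).
Proof.
case/cards1P => k /setP vw; exists k => j; have := vw j; rewrite !inE.
by case: (j == k); case: (tnth v j); case: (tnth w j).
Qed.

(** Coordinates are paired as [pos i false] and [pos i true].  At a vertex of
    parity vector [par v], the arc in direction [i] flips [pos i (par v i)]: on
    the i-th copy of Q_2 this is the 4-cycle 00, 10, 11, 01.  Flipping either
    coordinate of the pair changes its parity, so exactly one end of each edge
    is its tail. *)
Lemma star_arboricity_half_cube n e :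
  half_cube_coloring n e -> star_arboricity (hypercube n) <= n./2 + e.
Proof.
case=> I [C [Z [col [[col_inj colZ colNZ] nI cardC]]]].
rewrite {}nI doubleK -cardC.
have cardIn : #|{: I * bool}| = #|I|.*2 by rewrite card_prod card_bool muln2.
pose pos (i : I) (b : bool) : 'I_(#|I|.*2) := cast_ord cardIn (enum_rank (i, b)).
have pos_inj i b j b' : (pos i b == pos j b') = (i == j) && (b == b').
  by rewrite (inj_eq (@cast_ord_inj _ _ _)) (inj_eq enum_rank_inj).
have posP k : exists i b, k = pos i b.
  exists (enum_val (cast_ord (esym cardIn) k)).1.
  exists (enum_val (cast_ord (esym cardIn) k)).2.
  by rewrite /pos -surjective_pairing enum_valK cast_ordKV.
pose par (v : #|I|.*2.-tuple bool) : {ffun I -> bool} :=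
  [ffun i => tnth v (pos i false) (+) tnth v (pos i true)].
pose step (v w : #|I|.*2.-tuple bool) i :=
  [forall j, tnth w j == tnth v j (+) (j == pos i (par v i))].
pose arc c (v w : #|I|.*2.-tuple bool) :=
  [exists i, step v w i && (c == col (par v) i)].
have par_flip v w i b : (forall j, tnth w j = tnth v j (+) (j == pos i b)) ->
    par w = flip (par v) i.
  move=> vw; apply/ffunP => j; rewrite !ffunE !vw !pos_inj.
  case: (j == i); rewrite /= ?addbF //; case: {vw} b => /=; rewrite ?addbF ?addbT.
    by rewrite addbN.
  by rewrite addNb.
have par_step v w i : step v w i -> par w = flip (par v) i.
  by move=> /forallP h; apply: (@par_flip _ _ _ (par v i)) => j; apply/eqP.
apply: (@star_arboricity_le_arcs (hypercube #|I|.*2) C arc).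
- move=> c v w w' /existsP[i /andP[/forallP vw /eqP ->]].
  move=> /existsP[i' /andP[/forallP vw' /eqP /col_inj ii']].
  by apply: eq_from_tnth => j; rewrite (eqP (vw j)) (eqP (vw' j)) ii'.
- move=> c v w z /existsP[i /andP[/par_step vw /eqP ->]].
  apply/existsP => -[j /andP[_ /eqP cE]].
  by have := colNZ (par w) j; rewrite -cE vw colZ.
- move=> v w /cube_adjP[k vw]; have [i [b kE]] := posP k.
  rewrite {}kE in vw.
  have wv j : tnth v j = tnth w j (+) (j == pos i b) by rewrite vw addbK.
  have pw := par_flip _ _ _ _ vw.
  have [bE|bE] := eqVneq b (par v i).
    exists (col (par v) i); apply/orP; left; apply/existsP; exists i.
    by rewrite eqxx andbT; apply/forallP => j; rewrite -bE vw.
  have {}bE : b = par w i.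
    by rewrite pw ffunE eqxx; move: bE; case: (par v i); case eqb: b.
  exists (col (par w) i); apply/orP; right; apply/existsP; exists i.
  by rewrite eqxx andbT; apply/forallP => j; rewrite -bE -wv.
Qed.

(** On a product, each factor keeps its own palette: both the dimensions and the
    numbers of colours add up. *)
Lemma half_cube_coloring_add n1 e1 n2 e2 :
  half_cube_coloring n1 e1 -> half_cube_coloring n2 e2 ->
  half_cube_coloring (n1 + n2) (e1 + e2).
Proof.
case=> I1 [C1 [Z1 [col1 [[inj1 in1 out1] nI1 cC1]]]].
case=> I2 [C2 [Z2 [col2 [[inj2 in2 out2] nI2 cC2]]]].
pose u1 (u : {ffun I1 + I2 -> bool}) : {ffun I1 -> bool} := [ffun i => u (inl i)].
pose u2 (u : {ffun I1 + I2 -> bool}) : {ffun I2 -> bool} := [ffun i => u (inr i)].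
pose Z u : {set C1 + C2} :=
  [set c | match c with inl c => c \in Z1 (u1 u) | inr c => c \in Z2 (u2 u) end].
pose col u (i : I1 + I2) : C1 + C2 :=
  match i with inl i => inl (col1 (u1 u) i) | inr i => inr (col2 (u2 u) i) end.
have u1_flip u i : u1 (flip u (inl i)) = flip (u1 u) i.
  by apply/ffunP => j; rewrite !ffunE.
have u2_flip u i : u2 (flip u (inr i)) = flip (u2 u) i.
  by apply/ffunP => j; rewrite !ffunE.
exists (I1 + I2)%type, (C1 + C2)%type, Z, col; split.
- split=> u.
  + by move=> [i|i] [j|j] //= [] => [/inj1|/inj2] ->.
  + by case=> i; rewrite inE /= ?u1_flip ?u2_flip.
  + by case=> i; rewrite inE /=.
- by rewrite nI1 nI2 card_sum doubleD.
- by rewrite !card_sum cC1 cC2; lia.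
Qed.

(** * Colourings from the Hamming syndrome *)

Import GRing.Theory.
Local Open Scope ring_scope.

Section Syndrome.

Variable m : nat.
Notation V := 'rV['F_2]_m.
Notation dir := {d : V | d != 0}.

Definition syndrome (I : finType) (h : I -> V) (u : {ffun I -> bool}) : V :=
  \sum_i h i *+ u i.

Lemma addVV (x : V) : x + x = 0.
Proof. by apply/rowP => i; rewrite !mxE addrr_pchar2 ?pchar_Fp. Qed.

Lemma syndrome_flip (I : finType) (h : I -> V) u i :
  syndrome h (flip u i) = syndrome h u + h i.
Proof.
rewrite /syndrome (bigD1 i) //= [in RHS](bigD1 i) //= ffunE eqxx addbT.
rewrite addrAC; congr (_ + _).
  by case: (u i) => /=; rewrite ?mulr0n ?mulr1n ?add0r ?addVV.
by apply: eq_bigr => j /negbTE ji; rewrite ffunE ji addbF.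
Qed.

Lemma card_V : #|{: V}| = (2 ^ m)%N.
Proof. by rewrite card_mx card_Fp // mul1n. Qed.

Lemma card_dir : #|{: dir}| = (2 ^ m - 1)%N.
Proof. by rewrite card_sig cardC1 card_V subn1. Qed.

(** With the directions indexed by the nonzero vectors of V, flipping a direction
    adds it to the syndrome; so the arcs entering a vertex all carry its
    syndrome, and those leaving it carry the other elements of V, once each. *)
Lemma half_cube_coloring_hamming : half_cube_coloring (2 ^ m.+1 - 2) 1.
Proof.
pose g := @syndrome dir val.
exists dir, V, (fun u => [set g u]), (fun u d => g u + val d); split.
- split=> u.
  + by move=> d d' /addrI /val_inj.
  + by move=> d; rewrite inE /g syndrome_flip.
  + by move=> d; rewrite inE -subr_eq0 addrC addKr (valP d).
- by rewrite card_dir -muln2 mulnBl expnS mulnC.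
- by rewrite card_V card_dir subnK ?expn_gt0.
Qed.

(** A vertex of Q_(2^m - 1) x Q_2 is a centre in one colour [s u] of V, a
    translate of its syndrome, and in one of three extra colours [E u].  If
    every vertex saw the two extra colours other than its own on its
    neighbours in the Q_2 factor, these two colours and those of V would serve
    for all leaving arcs; but that would take four extra colours.  With three, the two
    vertices 00 and 11 of each Q_2 share the colour [None], so 01 and 10 see
    [None] twice and miss one colour.  The repair is to let the colours of 01
    and 10 be swapped when the coordinate [delta] is flipped: the missing colour
    is then found in direction [delta].  The colour of V usually given to that arc
    goes to the arc towards 00, where it is a centre colour because [s] is
    shifted by [delta] on [diag]. *)
Lemma half_cube_coloring_hamming_square :
  (0 < m)%N -> half_cube_coloring (2 ^ m.+1 + 2) 2.
Proof.
move=> m_gt0.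
have delta_neq0 : (const_mx 1 : V) != 0.
  by apply/eqP => /rowP /(_ (Ordinal m_gt0)); rewrite !mxE.
pose delta : dir := Sub (const_mx 1 : V) delta_neq0.
pose I : finType := (dir + bool)%type.
pose C : finType := (V + option bool)%type.
pose g (u : {ffun I -> bool}) := syndrome (fun d : dir => val d) [ffun d => u (inl d)].
pose diag (u : {ffun I -> bool}) := u (inr false) == u (inr true).
pose E u : option bool :=
  if diag u then None else Some (u (inr false) (+) u (inl delta)).
pose s u : V := g u + (if diag u then val delta else 0).
pose Z u : {set C} := [set inl (s u); inr (E u)].
pose col u (i : I) : C :=
  match i with
  | inl d => if ~~ diag u && (d == delta) then inr (E (flip u i)) else inl (s u + val d)
  | inr b => if diag u then inr (E (flip u i))
             else if u (inr b) then inl (s u + val delta) else inr None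
  end.
have g_flipl u d : g (flip u (inl d)) = g u + val d.
  by rewrite /g -syndrome_flip; congr syndrome; apply/ffunP => d'; rewrite !ffunE.
have g_flipr u b : g (flip u (inr b)) = g u.
  by congr syndrome; apply/ffunP => d'; rewrite !ffunE addbF.
have diag_flipl u d : diag (flip u (inl d)) = diag u by rewrite /diag !ffunE !addbF.
have diag_flipr u b : diag (flip u (inr b)) = ~~ diag u.
  rewrite /diag !ffunE !(inj_eq (@inr_inj _ _)).
  by case: b; case: (u (inr false)); case: (u (inr true)).
have s_flipl u d : s (flip u (inl d)) = s u + val d.
  by rewrite /s g_flipl diag_flipl addrAC.
exists I, C, Z, col; split.
- split=> u.
  + rewrite /col; case Du: (diag u) => -[d|b] [d'|b'] //=.
    * by case=> /addrI /val_inj ->.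
    (* The neighbours 01 and 10 of 00 or 11 have different extra colours. *)
    * rewrite /E !diag_flipr Du /= !ffunE !(inj_eq (@inr_inj _ _)).
      by case: b; case: b'; case: (u (inr false)); case: (u (inl delta)).
    * by do 2!case: eqP => [->|_] //; case=> // /addrI /val_inj ->.
    * case: eqP => [->|d_delta].
        by rewrite /E diag_flipl Du; case: (u (inr b')).
      by case: (u (inr b')) => // -[] /addrI d_eq; case: d_delta; apply: val_inj.
    * case: eqP => [->|d_delta].
        by rewrite /E diag_flipl Du; case: (u (inr b)).
      by case: (u (inr b)) => // -[] /addrI d_eq; case: d_delta; apply: val_inj.
    * move: Du; rewrite /diag; case: b; case: b' => //;
        by case: (u (inr false)); case: (u (inr true)).
  + case=> [d|b]; rewrite /col !inE.
      by case: ifP => _; rewrite ?s_flipl ?eqxx ?orbT.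
    case: ifP => Du; first by rewrite eqxx orbT.
    case: ifP => ub; last by rewrite /E diag_flipr Du eqxx orbT.
    by rewrite /s g_flipr diag_flipr Du addr0 eqxx.
  + have sNd (d : dir) : s u + val d != s u.
      by rewrite -subr_eq0 addrC addKr (valP d).
    case=> [d|b]; rewrite /col !inE negb_or.
      case: ifP => [/andP[Du /eqP->]|_]; last by rewrite (inj_eq (@inl_inj _ _)) sNd.
      rewrite /= /E diag_flipl (negbTE Du) !ffunE eqxx.
      by case: (u (inr false)); case: (u (inl delta)).
    case: ifP => Du; first by rewrite /E diag_flipr Du.
    case: ifP => ub; first by rewrite (inj_eq (@inl_inj _ _)) sNd.
    by rewrite /E Du.
- by rewrite card_sum card_dir card_bool; move: (expn_gt0 2 m); rewrite expnS; lia.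
- by rewrite !card_sum card_V card_dir card_option card_bool; move: (expn_gt0 2 m); lia.
Qed.

End Syndrome.

Local Close Scope ring_scope.

(** * Representations of even numbers *)

Lemma half_cube_coloring_setR r : setR r -> half_cube_coloring r 2.
Proof.
have base i : 2 <= i -> half_cube_coloring (2 ^ i - 2) 1.
  by case: i => // i _; apply: half_cube_coloring_hamming.
case=> [[[//|[|k]] _ ->]|[s [t [t_ge2 le_ts ->]]]].
(* 4 = 2 ^ 1 + 2 is outside the second family, which needs m > 0. *)
- exact (half_cube_coloring_add (base 2 isT) (base 2 isT)).
- exact: half_cube_coloring_hamming_square.
- have -> : 2 ^ s + 2 ^ t - 4 = (2 ^ s - 2) + (2 ^ t - 2).
    have := leq_pexp2l (isT : 0 < 2) t_ge2.
    by have := leq_pexp2l (isT : 0 < 2) (leq_trans t_ge2 le_ts); lia.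
  exact (half_cube_coloring_add (base s (leq_trans t_ge2 le_ts)) (base t t_ge2)).
Qed.

Lemma half_cube_coloring_representable n l :
  representable n l -> half_cube_coloring n (l + 2).
Proof.
case=> i [r [/half_cube_coloring_setR Rr _ i_ge2 ->]].
rewrite -(big_tuple _ _ i xpredT (fun j => 2 ^ j - 2)) -[l in l + 2](size_tuple i).
elim: (tval i) i_ge2 => [_|j s IHs /= /andP[j_ge2 /IHs dc]]; first by rewrite big_nil.
rewrite big_cons -addnA -[(size s).+1]add1n -addnA; apply: half_cube_coloring_add dc.
by case: j j_ge2 => // j _; apply: half_cube_coloring_hamming.
Qed.

(** Greedy choice, on halves: the largest admissible summand is 2^(j+1) - 1, and
    what is left after subtracting it is at most 2^(j+1) + 1.  Below that bound
    the induction hypothesis only uses smaller exponents; at the bound the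
    remainder is half of 2^(j+2) + 2, which is in R. *)
Lemma representation_exists j p : 2 <= p <= 2 ^ j.+1 ->
  exists (s : seq nat) (r : nat),
    [/\ setR r, path gtn j.+2 s, all (leq 2) s
      & p.*2 = \sum_(i <- s) (2 ^ i - 2) + r].
Proof.
elim: j p => [|j IHj] p /andP[p_ge2 p_le].
  have -> : p = 2 by rewrite expn1 in p_le; lia.
  by exists [::], 4; split; rewrite ?big_nil //; right; exists 2, 2.
have pow_gt0 := expn_gt0 2 j.
have [p_small|p_big] := leqP p (2 ^ j.+1).
  have [|s [r [Rr sorted_s s_ge2 pE]]] := IHj p; first by rewrite p_ge2.
  exists s, r; split=> //; case: s sorted_s {s_ge2 pE} => //= i s /andP[i_lt ->].
  by rewrite /= in i_lt *; rewrite andbT ltnS ltnW.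
pose q := p - (2 ^ j.+1 - 1).
have qE : p.*2 = (2 ^ j.+2 - 2) + q.*2 by rewrite expnS /q; lia.
have [q_big|q_neq] := eqVneq q (2 ^ j.+1).+1.
  exists [:: j.+2], (2 ^ j.+2 + 2); split=> //=.
  - by left; exists j.+2.
  - by rewrite andbT.
  - rewrite big_seq1 qE q_big; congr (_ + _).
    by rewrite doubleS -muln2 mulnC -expnS addn2.
have [|s [r [Rr sorted_s s_ge2 qsum]]] := IHj q.
  by move: p_le; rewrite /q !expnS in q_neq p_big *; lia.
exists (j.+2 :: s), r; split=> //=; first by rewrite sorted_s andbT.
by rewrite big_cons qE qsum addnA.
Qed.

Lemma least_nat (P : nat -> Prop) :
  (exists n, P n) -> exists2 n, P n & forall m, P m -> n <= m.
Proof.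
case=> n; elim/ltn_ind: n => n IHn Pn.
have [[m [lt_mn Pm]]|no_less] := classic (exists m, m < n /\ P m).
  exact: IHn lt_mn Pm.
exists n => // m Pm; rewrite leqNgt; apply/negP => lt_mn.
by apply: no_less; exists m.
Qed.

Theorem theorem3 (n : nat) (n_even : ~~ odd n) (n_ge4 : 4 <= n) :
  exists l : nat,
    [/\ representable n l,
        forall m : nat, representable n m -> l <= m
      & star_arboricity (hypercube n) <= n./2 + l + 2].
Proof.
have [|l repr_l l_min] := @least_nat (representable n).
  have nE : n = n./2.*2 by rewrite even_halfK.
  have [|s [r [Rr path_s s_ge2 sumE]]] := @representation_exists n./2 n./2.
    by have := ltn_expl n./2 (isT : 1 < 2); rewrite expnS; lia.
  exists (size s), (in_tuple s), r; split=> //; first exact: path_sorted path_s.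
  by rewrite -(big_tuple _ _ (in_tuple s) xpredT (fun j => 2 ^ j - 2)) -sumE.
exists l; split=> //; rewrite -addnA.
exact: star_arboricity_half_cube (half_cube_coloring_representable repr_l).
Qed.
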